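(* Let $p$ be a prime and $\mathbb{F}$ a field of characteristic $p$. Let $X$ be a (finite) simplicial complex of dimension $d$, $k\in\{0,\dots,d\}$, and $\mathcal{F}$ an $\mathbb{F}$-sheaf on $X$ with $h^{k-1}(X,\mathcal{F})=0$ and $h^k(X,\mathcal{F})>h^{k+1}(X,\mathcal{F})$. Put $\rho=(h^k(X,\mathcal{F})-h^{k+1}(X,\mathcal{F}))/\dim C^k(X,\mathcal{F})$. Let $u:Y\to X$ be a covering map of degree $p^r$ that factors as $Y=X_r\to X_{r-1}\to\dots\to X_0=X$ with each $X_i\to X_{i-1}$ a $C_p$-Galois covering. Then (i) $h^k(Y,u^*\mathcal{F})-h^{k+1}(Y,u^*\mathcal{F})\ge\rho\dim C^k(Y,u^*\mathcal{F})$; (ii) consequently $\dim Z^k(Y,u^*\mathcal{F})\ge\rho\dim C^k(Y,u^*\mathcal{F})$ and $h^k(Y,u^*\mathcal{F})\ge\rho\dim C^k(Y,u^*\mathcal{F})$, i.e. the rate of the $k$-cocycle code (resp. $k$-cocycle quantum CSS code) of $(Y,u^*\mathcal{F})$ is at least $\rho$.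
   Context: Simplicial complexes are finite; faces include $\emptyset$. An $\mathbb{F}$-sheaf $\mathcal{F}$ assigns finite-dimensional $\mathbb{F}$-spaces $\mathcal{F}(x)$ to nonempty faces and linear maps $\mathrm{res}_{y\leftarrow x}$ for nonempty $x\subsetneq y$ with $\mathrm{res}_{z\leftarrow y}\mathrm{res}_{y\leftarrow x}=\mathrm{res}_{z\leftarrow x}$. $C^k(X,\mathcal{F})$: alternating families over ordered $k$-faces (for sheaves $C^{-1}=0$), signed coboundary $d_k$, $Z^k=\ker d_k$, $B^k=\mathrm{im}\,d_{k-1}$, $H^k=Z^k/B^k$, $h^k=\dim_{\mathbb{F}}H^k$ (so $h^{-1}=0$). A morphism $u:Y\to X$ of simplicial complexes is a vertex map sending faces to faces; it is a covering map if surjective and for each vertex $y$ it restricts to a bijection from faces containing $y$ to faces containing $u(y)$; degree = common number of preimages of a vertex. A $G$-Galois covering is a covering $u:Y\to X$ with a $G$-action on $Y$ by simplicial automorphisms such that $u(gy)=u(y)$ and $G$ acts simply transitively on $u^{-1}(x)$ for each face $x$; $C_p$ is the cyclic group of order $p$. Pullback: $u^*\mathcal{F}(y)=\mathcal{F}(u(y))$, $\mathrm{res}^{u^*\mathcal{F}}_{y'\leftarrow y}=\mathrm{res}^{\mathcal{F}}_{u(y')\leftarrow u(y)}$. *)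

(* Defs.v *)
From HB Require Import structures.
From mathcomp Require Import all_boot all_order all_fingroup all_algebra all_solvable.

Set Implicit Arguments.
Unset Strict Implicit.
Unset Printing Implicit Defensive.

Import GRing.Theory.
Local Open Scope ring_scope.
Local Open Scope quotient_scope.

(* The library's vectType instance on finite functions only covers the
   constant-fibre case [{ffun I -> vT}]. *)

Definition fam (K : fieldType) (I : finType) (T : I -> vectType K) :=
  {dffun forall i : I, T i}.

Section Fam.
Import VectorInternalTheory.
Variables (K : fieldType) (I : finType) (T : I -> vectType K).
Implicit Types f g h : fam T.

HB.instance Definition _ := Choice.on (fam T).

Definition fam_zero : fam T := [ffun i : I => (0 : T i)].
Definition fam_opp f : fam T := [ffun i : I => - f i].
Definition fam_add f g : fam T := [ffun i : I => f i + g i].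
Definition fam_scale (a : K) f : fam T := [ffun i : I => a *: f i].

Fact fam_addA : associative fam_add.
Proof. by move=> f g h; apply/ffunP=> i; rewrite !ffunE addrA. Qed.
Fact fam_addC : commutative fam_add.
Proof. by move=> f g; apply/ffunP=> i; rewrite !ffunE addrC. Qed.
Fact fam_add0 : left_id fam_zero fam_add.
Proof. by move=> f; apply/ffunP=> i; rewrite !ffunE add0r. Qed.
Fact fam_addN : left_inverse fam_zero fam_opp fam_add.
Proof. by move=> f; apply/ffunP=> i; rewrite !ffunE addNr. Qed.

HB.instance Definition _ :=
  GRing.isZmodule.Build (fam T) fam_addA fam_addC fam_add0 fam_addN.

Fact fam_scaleA a b f : fam_scale a (fam_scale b f) = fam_scale (a * b) f.
Proof. by apply/ffunP=> i; rewrite !ffunE scalerA. Qed.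
Fact fam_scale1 : left_id 1 fam_scale.
Proof. by move=> f; apply/ffunP=> i; rewrite !ffunE scale1r. Qed.
Fact fam_scaleDr : right_distributive fam_scale +%R.
Proof. by move=> a f g; apply/ffunP=> i; rewrite !ffunE scalerDr. Qed.
Fact fam_scaleDl f : {morph fam_scale^~ f : a b / a + b}.
Proof. by move=> a b; apply/ffunP=> i; rewrite !ffunE scalerDl. Qed.

HB.instance Definition _ :=
  GRing.Zmodule_isLmodule.Build K (fam T)
    fam_scaleA fam_scale1 fam_scaleDr fam_scaleDl.

Lemma fam0E i : (0 : fam T) i = 0. Proof. exact: ffunE. Qed.
Lemma famDE f g i : (f + g) i = f i + g i. Proof. exact: ffunE. Qed.
Lemma famNE f i : (- f) i = - f i. Proof. exact: ffunE. Qed.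
Lemma famZE a f i : (a *: f) i = a *: f i. Proof. exact: ffunE. Qed.

Let castT i j (e : i = j) : T i -> T j := fun v => ecast k (T k) e v.

Fact fam_vect_iso :
  Vector.axiom (\sum_(j < #|I|) dim (T (enum_val j))) (fam T).
Proof.
pose fr f := \mxrow_(j < #|I|) (v2r (f (enum_val j)) : 'rV_(dim (T (enum_val j)))).
exists fr.
  move=> a f g; apply/mxrowP => j.
  have subZ (r : 'rV[K]_(\sum_(j < #|I|) dim (T (enum_val j)))) :
    submxrow (a *: r) j = a *: submxrow r j by apply/rowP=> l; rewrite !mxE.
  by rewrite submxrowD subZ !mxrowK famDE famZE linearP.
exists (fun r => [ffun i : I =>
    castT (enum_rankK i) (r2v (submxrow r (enum_rank i)))] : fam T) => [f|r].
  apply/ffunP => i; rewrite ffunE mxrowK v2rK.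
  by move: (enum_rankK i); move: (enum_val _) => j e; case: i / e.
apply/mxrowP => j; rewrite mxrowK ffunE.
have castE k (e : k = j) (e' : enum_val k = enum_val j) :
  v2r (castT e' (r2v (submxrow r k))) = submxrow r j.
  by case: j / e e' => e'; rewrite (eq_irrelevance e' erefl) r2vK.
exact: castE (enum_valK j) _.
Qed.

HB.instance Definition _ := Lmodule_hasFinDim.Build K (fam T) fam_vect_iso.

End Fam.

Section QuotientSpace.
Import VectorInternalTheory.
Variables (K : fieldType) (vT : vectType K) (U : {vspace vT}).

Definition vquot := Quotient.quot (pred_of_vspace U).

HB.instance Definition _ := GRing.Zmodule.on vquot.

Implicit Types q : vquot.

Local Notation repr := generic_quotient.repr.

Let pi (x : vT) : vquot := \pi_(Quotient.quot (pred_of_vspace U)) x.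

Let eq_pi x y : x - y \in U -> pi x = pi y.
Proof. by rewrite Quotient.idealrBE => /eqP. Qed.
Let pi_eq x y : pi x = pi y -> x - y \in U.
Proof. by move=> /eqP; rewrite Quotient.idealrBE. Qed.
Let piK q : pi (repr q) = q. Proof. exact: reprK. Qed.
Let piD x y : pi (x + y) = pi x + pi y. Proof. exact: raddfD. Qed.
Let reprB x : repr (pi x) - x \in U. Proof. by apply: pi_eq; rewrite piK. Qed.

Definition vquot_scale (a : K) q := pi (a *: repr q).

Let piZ a x : vquot_scale a (pi x) = pi (a *: x).
Proof. by apply: eq_pi; rewrite -scalerBr rpredZ. Qed.

Fact vquot_scaleA a b q :
  vquot_scale a (vquot_scale b q) = vquot_scale (a * b) q.
Proof. by rewrite -(piK q) !piZ scalerA. Qed.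
Fact vquot_scale1 : left_id 1 vquot_scale.
Proof. by move=> q; rewrite -(piK q) piZ scale1r. Qed.
Fact vquot_scaleDr : right_distributive vquot_scale +%R.
Proof.
by move=> a q1 q2; rewrite -(piK q1) -(piK q2) -piD !piZ -piD scalerDr.
Qed.
Fact vquot_scaleDl q : {morph vquot_scale^~ q : a b / a + b}.
Proof. by move=> a b; rewrite -(piK q) !piZ -piD scalerDl. Qed.

HB.instance Definition _ :=
  GRing.Zmodule_isLmodule.Build K vquot
    vquot_scaleA vquot_scale1 vquot_scaleDr vquot_scaleDl.

Fact vquot_vect_iso : Vector.axiom (dim (subvs_of (U^C)%VS)) vquot.
Proof.
pose W := subvs_of (U^C)%VS.
pose P x : W := vsproj (U^C)%VS (x - projv U x).
have PD a x y : P (a *: x + y) = a *: P x + P y.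
  rewrite /P -[RHS]linearP; congr (vsproj _ _).
  by rewrite linearP scalerBr opprD addrACA.
have P0 x : x \in U -> P x = 0.
  by move=> xU; rewrite /P projv_id // subrr linear0.
have Pr x : P (repr (pi x)) = P x.
  rewrite -[repr _](subrK x) -[_ - x]scale1r PD P0 ?scaler0 ?add0r //.
exists (fun q => v2r (P (repr q))).
  move=> a q1 q2; rewrite -linearP -PD /=; congr v2r.
  by rewrite -[in RHS]Pr piD -piZ !piK.
exists (fun r => pi (vsval (r2v r : W))) => [q|r] /=.
  rewrite v2rK -[in RHS](piK q); apply: eq_pi.
  by rewrite vsprojK ?memv_projC // addrC addKr rpredN memv_proj.
rewrite Pr -[RHS]r2vK; congr v2r; apply: val_inj.
set w := r2v r; have wC := subvsP w.
rewrite /P /= vsprojK ?memv_projC //.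
suff -> : projv U (vsval w) = 0 by rewrite subr0.
by apply/eqP; rewrite -memv_ker lker_proj.
Qed.

HB.instance Definition _ := Lmodule_hasFinDim.Build K vquot vquot_vect_iso.

Lemma dim_vquot : \dim {: vquot} = (\dim {: vT} - \dim U)%N.
Proof. by rewrite dimvf -dimv_compl. Qed.

End QuotientSpace.

(* The elements of [vert] are exactly the vertices, by [face1]. *)
Record scomplex := SComplex {
  vert :> finType;
  faces : {set {set vert}};
  face0 : set0 \in faces;
  face1 : forall v : vert, [set v] \in faces;
  faceS : forall x y : {set vert}, y \in faces -> x \subset y -> x \in faces
}.

Definition sdim (X : scomplex) : int := (\max_(x in faces X) #|x|)%:Z - 1.

Definition nface (X : scomplex) :=
  {x : {set X} | (x \in faces X) && (x != set0)}.

Record smorph (Y X : scomplex) := SMorph {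
  smap :> Y -> X;
  smap_face : forall y, y \in faces Y -> smap @: y \in faces X
}.

Definition star (X : scomplex) (v : X) : {set {set X}} :=
  [set x in faces X | v \in x].

Definition covering (Y X : scomplex) (u : smorph Y X) : Prop :=
  (forall x : X, exists y : Y, u y = x) /\
  (forall y : Y,
     {in star y &, injective (fun a : {set Y} => u @: a)} /\
     [set u @: a | a : {set Y} in star y] = star (u y)).

Definition has_degree (Y X : scomplex) (u : smorph Y X) (n : nat) : Prop :=
  forall x : X, #|u @^-1: [set x]| = n.

(* The fibre of the empty face is a single face, so simple transitivity on
   fibres is only meaningful over nonempty faces. *)
Definition galois_covering (gT : finGroupType) (Y X : scomplex)
    (u : smorph Y X) : Prop :=
  covering u /\
  exists to : {action gT &-> Y},
    [/\ forall (g : gT) (y : {set Y}),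
          y \in faces Y -> [set to v g | v in y] \in faces Y,
        forall (g : gT) (v : Y), u (to v g) = u v
      & forall x : {set X}, x \in faces X -> x != set0 ->
        forall y y' : {set Y}, y \in faces Y -> y' \in faces Y ->
          u @: y = x -> u @: y' = x ->
          exists! g : gT, [set to v g | v in y] = y'].

Definition cyclic_galois_covering (p : nat) (Y X : scomplex)
    (u : smorph Y X) : Prop :=
  exists gT : finGroupType,
    [/\ cyclic [set: gT], #|[set: gT]| = p & galois_covering gT u].

(* [cyclic_tower p r u]: [u] is the composite of a chain of length [r]
   Y = X_r -> ... -> X_0 = X of C_p-Galois coverings. *)
Inductive cyclic_tower (p : nat) (X : scomplex) :
    nat -> forall Y : scomplex, smorph Y X -> Prop :=
| CyclicTower0 (u : smorph X X) :
    u =1 id -> cyclic_tower p 0 u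
| CyclicTowerS (r : nat) (Z Y : scomplex)
    (v : smorph Z X) (w : smorph Y Z) (u : smorph Y X) :
    cyclic_tower p r v -> cyclic_galois_covering p w -> u =1 v \o w ->
    cyclic_tower p r.+1 u.

Record sheaf (K : fieldType) (X : scomplex) := Sheaf {
  stalk :> nface X -> vectType K;
  res : forall x y : nface X, val x \proper val y -> 'Hom(stalk x, stalk y);
  res_comp : forall (x y z : nface X) (xy : val x \proper val y)
    (yz : val y \proper val z) (xz : val x \proper val z),
    (res yz \o res xy)%VF = res xz
}.

Section Pullback.
Variables (K : fieldType) (Y X : scomplex) (u : smorph Y X).

Fact nimg_subproof (y : nface Y) :
  (u @: val y \in faces X) && (u @: val y != set0).
Proof.
case: y => y /= /andP[yF y0]; rewrite smap_face //=.
by case/set0Pn: y0 => v vy; apply/set0Pn; exists (u v); apply: imset_f.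
Qed.

Definition nimg (y : nface Y) : nface X := Sub (u @: val y) (nimg_subproof y).

Hypothesis cov_u : covering u.

Fact nimg_proper (y y' : nface Y) :
  val y \proper val y' -> val (nimg y) \proper val (nimg y').
Proof.
case: y y' => [y /= /andP[yF /set0Pn[v vy]]] [y' /= /andP[y'F _]].
move=> pyy'; have syy' := proper_sub pyy'.
rewrite properEneq imsetS // andbT; apply: contraNneq (proper_neq pyy') => uyy'.
apply/eqP; have [+ _] := cov_u.2 v; apply=> //; rewrite inE ?yF ?y'F //.
exact: (subsetP syy').
Qed.

Definition pullback (F : sheaf K X) : sheaf K Y :=
  @Sheaf K Y (fun y => F (nimg y))
    (fun y y' yy' => res F (nimg_proper yy'))
    (fun x y z xy yz xz =>
       res_comp F (nimg_proper xy) (nimg_proper yz) (nimg_proper xz)).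

End Pullback.

Section Cochains.
Variable X : scomplex.

Definition oface (k : nat) :=
  {s : k.+1.-tuple X | uniq s && ([set v in s] \in faces X)}.

HB.instance Definition _ k := Finite.on (oface k).

Fact oset_subproof k (s : oface k) :
  ([set v in val s] \in faces X) && ([set v in val s] != set0).
Proof.
case: s => s /= /andP[_ ->] /=.
by apply/set0Pn; exists (tnth s ord0); rewrite inE mem_tnth.
Qed.

Definition oset k (s : oface k) : nface X :=
  Sub [set v in val s] (oset_subproof s).

Definition perm_tuple k (s : oface k) (sg : 'S_k.+1) : k.+1.-tuple X :=
  [tuple tnth (val s) (sg i) | i < k.+1].

Definition del_tuple k (s : oface k.+1) (i : 'I_k.+2) : k.+1.-tuple X :=
  [tuple tnth (val s) (lift i j) | j < k.+1].

Fact operm_set k (s : oface k) (sg : 'S_k.+1) :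
  [set v in perm_tuple s sg] = [set v in val s].
Proof.
apply/setP=> v; rewrite !inE; apply/tnthP/tnthP => -[i ->].
  by exists (sg i); rewrite tnth_mktuple.
by exists ((sg^-1)%g i); rewrite tnth_mktuple permKV.
Qed.

Fact operm_subproof k (s : oface k) (sg : 'S_k.+1) :
  uniq (perm_tuple s sg) && ([set v in perm_tuple s sg] \in faces X).
Proof.
rewrite operm_set; have /andP[us ->] := valP s.
by rewrite andbT map_inj_uniq ?enum_uniq // => i j /(tuple_uniqP _ us) /perm_inj.
Qed.

Definition operm k (s : oface k) (sg : 'S_k.+1) : oface k :=
  Sub (perm_tuple s sg) (operm_subproof s sg).

Lemma oset_perm k (s : oface k) (sg : 'S_k.+1) : oset s = oset (operm s sg).
Proof. by apply: val_inj; rewrite /= operm_set. Qed.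

Fact odel_sub k (s : oface k.+1) (i : 'I_k.+2) :
  [set v in del_tuple s i] \subset [set v in val s].
Proof.
by apply/subsetP=> v; rewrite !inE => /tnthP[j ->]; rewrite tnth_mktuple mem_tnth.
Qed.

Fact odel_subproof k (s : oface k.+1) (i : 'I_k.+2) :
  uniq (del_tuple s i) && ([set v in del_tuple s i] \in faces X).
Proof.
have /andP[us sF] := valP s; rewrite (faceS sF (odel_sub s i)) andbT.
by rewrite map_inj_uniq ?enum_uniq // => a b /(tuple_uniqP _ us) /lift_inj.
Qed.

Definition odel k (s : oface k.+1) (i : 'I_k.+2) : oface k :=
  Sub (del_tuple s i) (odel_subproof s i).

Fact odel_proper k (s : oface k.+1) (i : 'I_k.+2) :
  val (oset (odel s i)) \proper val (oset s).
Proof.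
rewrite properE odel_sub; apply/subsetPn; exists (tnth (val s) i).
  by rewrite inE mem_tnth.
rewrite inE; apply/tnthP=> -[j]; rewrite tnth_mktuple.
have /andP[us _] := valP s.
by move=> /(tuple_uniqP _ us) /eqP; rewrite (negPf (neq_lift i j)).
Qed.

Variables (K : fieldType) (F : sheaf K X).

Definition stalk_cast (x y : nface X) (e : x = y) (a : F x) : F y :=
  ecast z (F z) e a.

Fact stalk_cast_is_linear x y (e : x = y) : linear (stalk_cast e).
Proof. by case: y / e. Qed.

HB.instance Definition _ x y (e : x = y) :=
  GRing.isLinear.Build K (F x) (F y) _ (stalk_cast e) (stalk_cast_is_linear e).

Definition ofam (k : nat) := fam (fun s : oface k => F (oset s)).

HB.instance Definition _ k := Vector.on (ofam k).

(* Vanishes exactly on the families [f] with f(s o sg) = sgn(sg) f(s). *)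
Definition alt_defect k (s : oface k) (sg : 'S_k.+1) (f : ofam k) :
    F (oset (operm s sg)) :=
  f (operm s sg) - (-1) ^+ odd_perm sg *: stalk_cast (oset_perm s sg) (f s).

Fact alt_defect_is_linear k (s : oface k) sg : linear (alt_defect s sg).
Proof.
move=> a f g; rewrite /alt_defect !famDE !famZE linearP.
by rewrite scalerDr opprD addrACA scalerBr !scalerA [_ * a]mulrC.
Qed.

HB.instance Definition _ k (s : oface k) sg :=
  GRing.isLinear.Build K (ofam k) (F (oset (operm s sg))) _
    (alt_defect s sg) (alt_defect_is_linear s sg).

Definition cochains (k : nat) : {vspace ofam k} :=
  (\bigcap_(s : oface k) \bigcap_(sg : 'S_k.+1) lker (linfun (alt_defect s sg)))%VS.

Lemma cochainsP k (f : ofam k) :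
  reflect (forall (s : oface k) (sg : 'S_k.+1),
             f (operm s sg) =
             (-1) ^+ odd_perm sg *: stalk_cast (oset_perm s sg) (f s))
          (f \in cochains k).
Proof.
rewrite memvE; apply: (iffP subv_bigcapP) => [fP s sg|fP s _].
  have /subv_bigcapP/(_ sg isT) := fP s isT.
  by rewrite -memvE memv_ker lfunE /= subr_eq0 => /eqP.
apply/subv_bigcapP=> sg _; rewrite -memvE memv_ker lfunE /= subr_eq0.
exact/eqP/fP.
Qed.

Definition coboundary_fun k (f : ofam k) : ofam k.+1 :=
  [ffun s : oface k.+1 =>
    \sum_(i < k.+2) (-1) ^+ i *: res F (odel_proper s i) (f (odel s i))].

Fact coboundary_is_linear k : linear (@coboundary_fun k).
Proof.
move=> a f g; apply/ffunP=> s; rewrite famDE famZE !ffunE scaler_sumr -big_split.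
apply: eq_bigr => i _ /=; rewrite famDE famZE linearP scalerDr !scalerA.
by rewrite [_ * a]mulrC.
Qed.

HB.instance Definition _ k :=
  GRing.isLinear.Build K (ofam k) (ofam k.+1) _
    (@coboundary_fun k) (@coboundary_is_linear k).

Definition coboundary k : 'Hom(ofam k, ofam k.+1) := linfun (@coboundary_fun k).

Lemma coboundaryE k (f : ofam k) (s : oface k.+1) :
  coboundary k f s =
  \sum_(i < k.+2) (-1) ^+ i *: res F (odel_proper s i) (f (odel s i)).
Proof. by rewrite lfunE /= ffunE. Qed.

Definition cocycles (k : nat) : {vspace ofam k} :=
  (cochains k :&: lker (coboundary k))%VS.

Definition coboundaries (k : nat) : {vspace ofam k} :=
  match k with
  | 0 => 0%VS
  | j.+1 => (coboundary j @: cochains j)%VS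
  end.

Definition cohomology (k : nat) : vectType K :=
  vquot (linfun (vsval : subvs_of (cocycles k) -> ofam k) @^-1: coboundaries k)%VS.

(* h^k = 0 in negative degrees, since C^k = 0 there. *)
Definition hdim (k : int) : nat :=
  if k is Posz n then \dim {: cohomology n} else 0.

Definition cocycle_code_rate (k : nat) : rat :=
  (\dim (cocycles k))%:R / (\dim (cochains k))%:R.

Definition cocycle_css_rate (k : nat) : rat :=
  (hdim k)%:R / (\dim (cochains k))%:R.

End Cochains.

(* Main.v *)
(* Write [c^j] and [b^j] for the dimensions of [C^j] and [B^j], so that
   [h^j = c^j - b^j - b^(j+1)].  When [h^(k-1) = 0], the difference
   [h^k - h^(k+1)] equals [c^k - c^(k+1) - c^(k-1) + b^(k-1) + b^(k+2)], hence it
   suffices that a tower of degree [p^r] multiplies each [c^j] by [p^r] exactly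
   and each [b^j] by [p^r] at least.

   For one C_p-Galois covering let [s] be the translation by a generator and
   [T = 1 - s].  In characteristic [p], [T^p = 0] and [T^(p-1)] is the norm
   [1 + s + ... + s^(p-1)].  On an [s]-stable space [W] this gives
   [p * dim (T^(p-1) W) <= dim W <= p * dim (W :&: ker T)].  As the group acts
   freely on faces, both the norms and the fixed points of cochains upstairs are
   exactly the pulled back cochains. *)

From HB Require Import structures.
Require Import Defs.
From mathcomp Require Import all_boot all_order all_fingroup all_algebra all_solvable.
From mathcomp Require Import zify.

Set Implicit Arguments.
Unset Strict Implicit.
Unset Printing Implicit Defensive.

Import Order.TTheory GRing.Theory Num.Theory.
Local Open Scope ring_scope.

(** * Dimensions under a unipotent operator *)

Section NilpotentDim.
Variables (K : fieldType) (vT : vectType K) (T : 'End(vT)).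
Implicit Types W U : {vspace vT}.

Lemma mem_iter_limg n W v :
  reflect (exists2 w, w \in W & v = iter n T w) (v \in iter n (lfun_img T) W).
Proof.
elim: n v => [|n IHn] v /=.
  by apply: (iffP idP) => [vW|[w wW ->]] //; exists v.
apply: (iffP memv_imgP) => [[u /IHn[w wW ->] ->]|[w wW ->]]; first by exists w.
by exists (iter n T w) => //; apply/IHn; exists w.
Qed.

Variables (W : {vspace vT}) (TW : (T @: W <= W)%VS).
Variables (n : nat) (Tn0 : {in W, forall w, iter n.+1 T w = 0}).

Let iter_limgS i : (iter i.+1 (lfun_img T) W <= iter i (lfun_img T) W)%VS.
Proof. by elim: i => //= i IHi; apply: limgS. Qed.

Let iter_limg_sub i j :
  (i <= j)%N -> (iter j (lfun_img T) W <= iter i (lfun_img T) W)%VS.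
Proof.
elim: j => [|j IHj]; first by rewrite leqn0 => /eqP->.
rewrite leq_eqVlt => /predU1P[-> //|/IHj]; exact/subv_trans.
Qed.

Let iter_limg0 : iter n.+1 (lfun_img T) W = 0%VS.
Proof.
by apply/eqP; rewrite -subv0; apply/subvP=> v /mem_iter_limg[w wW ->]; rewrite Tn0 ?mem0v.
Qed.

(** In the chain W, T W, ..., T^n W, 0 each drop in dimension is the dimension of the part of T^i W
    killed by [T]. The space [U] lies in T^n W, hence in every term of the chain, and [T] kills it,
    so each of the n+1 drops is at least dim U. The induction climbs from the zero end of the
    chain. *)
Lemma nilpotent_dim_ge U :
  {in U, forall v, exists2 w, w \in W & v = iter n T w} ->
  (n.+1 * \dim U <= \dim W)%N.
Proof.
move=> UW; suff IH i : (i <= n.+1)%N ->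
    (i * \dim U <= \dim (iter (n.+1 - i) (lfun_img T) W))%N.
  by have := IH n.+1 (leqnn _); rewrite subnn.
elim: i => // i IHi ltin; have := IHi (ltnW ltin).
rewrite ltnS in ltin; rewrite subSn // subSS /=.
rewrite -[in X in _ -> (_ <= X)%N](limg_ker_dim T) mulSn => le_i.
apply: leq_add le_i; apply/dimvS/subvP=> v vU; rewrite memv_cap; apply/andP; split.
  have /subvP := iter_limg_sub (leq_subr i n); apply.
  exact/mem_iter_limg/UW.
rewrite memv_ker; have [w wW ->] := UW v vU.
by have := Tn0 wW => /= ->.
Qed.

(** The same n+1 drops are each at most the dimension of the kernel of [T] on [W]. *)
Lemma nilpotent_dim_le : (\dim W <= n.+1 * \dim (W :&: lker T))%N.
Proof.
suff IH i : (i <= n.+1)%N ->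
    (\dim (iter (n.+1 - i) (lfun_img T) W) <= i * \dim (W :&: lker T))%N.
  by have := IH n.+1 (leqnn _); rewrite subnn.
elim: i => [_|i IHi ltin]; first by rewrite subn0 iter_limg0 dimv0.
have := IHi (ltnW ltin); rewrite ltnS in ltin; rewrite subSn // subSS /= => le_i.
rewrite -(limg_ker_dim T) mulSn; apply: leq_add le_i.
by apply: dimvS; apply: capvS => //; apply: (iter_limg_sub (leq0n _)).
Qed.

End NilpotentDim.

(** * Operators of order dividing p in characteristic p *)

Section CyclicDim.
Variables (p : nat) (p_prime : prime p) (K : fieldType) (charK : p \in [pchar K]).

(** By Pascal's rule two neighbouring coefficients add up to ['C(p, i.+1)], which p divides, so the
    sign alternates. *)
Lemma bin_pred_pchar i : (i < p)%N -> ('C(p.-1, i))%:R = (-1) ^+ i :> K.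
Proof.
elim: i => [|i IHi] ltip; first by rewrite bin0.
have := dvdn_pcharf charK 'C(p, i.+1); rewrite prime_dvd_bin //=.
rewrite -{1}(prednK (prime_gt0 p_prime)) binS natrD IHi ?(ltnW ltip) //.
by move=> /esym; rewrite addr_eq0 exprS mulN1r => /eqP.
Qed.

Variables (vT : vectType K) (s : 'End(vT)).

Lemma iter_1sub n v :
  iter n (\1 - s)%VF v = \sum_(i < n.+1) ((-1) ^+ i * ('C(n, i))%:R) *: iter i s v.
Proof.
elim: n => [|n IHn]; first by rewrite big_ord1 expr0 mul1r scale1r.
rewrite iterS IHn add_lfunE opp_lfunE id_lfunE linear_sum /=.
rewrite [RHS]big_ord_recl /= big_ord_recl /= !bin0 -addrA; congr (_ + _).
under [in RHS]eq_bigr => i _ do rewrite /bump /= add1n binS natrD mulrDr scalerDl.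
rewrite big_split /=; congr (_ + _).
  rewrite [RHS]big_ord_recr /= bin_small // mulr0 scale0r addr0.
  by apply: eq_bigr => i _; rewrite /bump /= add1n.
rewrite -sumrN; apply: eq_bigr => i _.
by rewrite linearZ /= exprS mulN1r mulNr scaleNr.
Qed.

(** The sign of the binomial expansion and the sign of ['C(p.-1, i)] cancel, which leaves the
    norm. *)
Lemma iter_1sub_pchar v :
  iter p.-1 (\1 - s)%VF v = \sum_(i < p) iter i s v.
Proof.
rewrite iter_1sub; have p_gt0 := prime_gt0 p_prime; rewrite prednK //.
apply: eq_bigr => i _.
by rewrite bin_pred_pchar // -expr2 sqrr_sign scale1r.
Qed.

Variables (W : {vspace vT}) (sW : (s @: W <= W)%VS).
Hypothesis sp : {in W, forall w, iter p s w = w}.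

Let subW : ((\1 - s) @: W <= W)%VS.
Proof.
apply/subvP=> v /memv_imgP[w wW ->]; rewrite add_lfunE opp_lfunE id_lfunE.
by rewrite rpredB // (subvP sW) // memv_img.
Qed.

(** Applying [s] to the norm of [w] shifts its terms cyclically, because s^p w = w; so 1 - s kills
    the norm. *)
Let subW0 : {in W, forall w, iter p.-1.+1 (\1 - s)%VF w = 0}.
Proof.
move=> w wW; rewrite iterS iter_1sub_pchar add_lfunE opp_lfunE id_lfunE.
case: p p_prime sp => // q _ sq; rewrite linear_sum /= big_ord_recl /=.
rewrite [X in _ - X]big_ord_recr /= -iterS sq // [X in _ - X]addrC opprD addrACA.
rewrite subrr add0r; apply/eqP; rewrite subr_eq0; apply/eqP.
by apply: eq_bigr.
Qed.

Lemma cyclic_dim_ge (U : {vspace vT}) :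
  {in U, forall v, exists2 w, w \in W & v = \sum_(i < p) iter i s w} ->
  (p * \dim U <= \dim W)%N.
Proof.
move=> UW; rewrite -(prednK (prime_gt0 p_prime)).
apply: (nilpotent_dim_ge subW subW0) => v /UW[w wW ->].
by exists w; rewrite ?iter_1sub_pchar.
Qed.

Lemma cyclic_dim_le (U : {vspace vT}) :
  {in W, forall w, s w = w -> w \in U} -> (\dim W <= p * \dim U)%N.
Proof.
move=> WU; apply: leq_trans (nilpotent_dim_le subW subW0) _.
rewrite prednK ?prime_gt0 // leq_mul2l; apply/orP; right.
apply/dimvS/subvP=> w; rewrite memv_cap memv_ker => /andP[wW].
by rewrite add_lfunE opp_lfunE id_lfunE subr_eq0 => /eqP sw; apply: WU.
Qed.

End CyclicDim.

(** * The cochain complex *)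

(** Here [t] is what remains of [s] once position [i] and its image are removed. It compares
    deleting a vertex before and after reordering a face. *)
Lemma perm_lift_factor n (s : 'S_n.+1) (i : 'I_n.+1) :
  exists t : 'S_n, lift_perm i (s i) t = s.
Proof.
(* The default [k] is never reached, since [s (lift i k)] differs from [s i]. *)
pose f (k : 'I_n) := odflt k (unlift (s i) (s (lift i k))).
have fK k : lift (s i) (f k) = s (lift i k).
  rewrite /f; have := neq_lift i k.
  by rewrite -(inj_eq (@perm_inj _ s)) => /unlift_some[] ? ? ->.
have f_inj : injective f.
  by move=> k l /(congr1 (lift (s i))); rewrite !fK => /perm_inj/lift_inj.
exists (perm f_inj); apply/permP=> k.
by case: (unliftP i k) => [l|] ->; rewrite ?lift_perm_id // lift_perm_lift permE fK.
Qed.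

(** For j <= i the terms at (i+1, j) and (j, i) carry opposite signs, and these pairs exhaust the
    sum. *)
Lemma alternating_double_sum (K : pzRingType) (V : lmodType K) n (G : nat -> nat -> V) :
  (forall i j, (j <= i < n)%N -> G i.+1 j = G j i) ->
  \sum_(i < n.+1) \sum_(j < n) (-1) ^+ (i + j) *: G i j = 0.
Proof.
move=> GE; pose A i j := (-1) ^+ (i + j) *: G i j.
transitivity (\sum_(i < n.+1) \sum_(j < n | (j < i)%N) A i j +
              \sum_(i < n.+1) \sum_(j < n | ~~ (j < i)%N) A i j).
  by rewrite -big_split; apply: eq_bigr => i _;
    rewrite [LHS](bigID (fun j : 'I_n => (j < i)%N)).
(* Row 0 of the part below the diagonal and row n of the other part are empty. Once they are
   dropped, exchanging the sums in the second part makes both run over the same pairs. *)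
rewrite big_ord_recl big1 // add0r [X in _ + X]big_ord_recr /=.
rewrite [X in _ + (_ + X)]big1 ?addr0; last first.
  by move=> j; rewrite ltn_ord.
rewrite [X in _ + X](exchange_big_dep predT) //= -big_split /=; apply: big1 => i _.
under [X in _ + X]eq_bigl => j do rewrite -leqNgt.
rewrite -big_split /=; apply: big1 => j ji.
rewrite /A /bump /= add1n GE; last by rewrite ltn_ord andbT.
by rewrite addSn exprS mulN1r scaleNr [(j + i)%N]addnC addNr.
Qed.

Section Complex.
Variables (X : scomplex) (K : fieldType) (F : sheaf K X).

Lemma tnth_odel k (s : oface X k.+1) i j :
  tnth (val (odel s i)) j = tnth (val s) (lift i j).
Proof. by rewrite /= tnth_mktuple. Qed.

Lemma tnth_operm k (s : oface X k) sg i :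
  tnth (val (operm s sg)) i = tnth (val s) (sg i).
Proof. by rewrite /= tnth_mktuple. Qed.

Lemma oface_inj k (s t : oface X k) :
  (forall i, tnth (val s) i = tnth (val t) i) -> s = t.
Proof. by move=> st; apply/val_inj/eq_from_tnth. Qed.

Lemma res_irrelevant (x y : nface X) (e e' : val x \proper val y) : res F e = res F e'.
Proof. by rewrite (eq_irrelevance e e'). Qed.

(** The values [f s] and [f t] live in different types, but their restrictions to [y] can be equated
    without a transport. *)
Lemma res_eq k (s t : oface X k) (y : nface X) (f : ofam F k)
    (e : val (oset s) \proper val y) (e' : val (oset t) \proper val y) :
  s = t -> res F e (f s) = res F e' (f t).
Proof. by move=> st; case: t / st e' => e'; rewrite (res_irrelevant e e'). Qed.

Lemma res_cast (x x' y y' : nface X) (ex : x = x') (ey : y = y')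
    (e : val x \proper val y) (e' : val x' \proper val y') (a : F x) :
  res F e' (stalk_cast ex a) = stalk_cast ey (res F e a).
Proof. by case: x' / ex e'; case: y' / ey => e'; rewrite (res_irrelevant e e'). Qed.

Lemma coboundary_coboundary k (f : ofam F k) : coboundary F k.+1 (coboundary F k f) = 0.
Proof.
apply/ffunP=> s; rewrite fam0E coboundaryE.
have ss i j : val (oset (odel (odel s i) j)) \proper val (oset s).
  exact: proper_trans (odel_proper _ j) (odel_proper s i).
(* [inord] extends the family of double deletions to natural indices; all indices that occur are in
   range. *)
pose G i j := res F (ss (inord i) (inord j)) (f (odel (odel s (inord i)) (inord j))).
rewrite -[RHS](alternating_double_sum (n := k.+2) (G := G)); last first.
  move=> i j /andP[ji ik]; rewrite /G; apply: res_eq; apply: oface_inj => l.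
  rewrite !tnth_odel; congr tnth; apply: val_inj => /=.
  rewrite !inordK ?ltnS ?(leq_ltn_trans ji) // /bump; lia.
apply: eq_bigr => i _; rewrite coboundaryE linear_sum scaler_sumr; apply: eq_bigr => j _.
rewrite linearZ /= scalerA -exprD -comp_lfunE (res_comp F _ _ (ss i j)).
by rewrite /G !inord_val.
Qed.

(** Deleting position [j] of a permuted face gives a permutation [t] of the face with position [i] =
    [sg j] deleted, so the sum is reindexed by the inverse of [sg]. *)
Lemma coboundary_cochains k :
  (coboundary F k @: cochains F k <= cochains F k.+1)%VS.
Proof.
apply/subvP=> _ /memv_imgP[f /cochainsP fP ->]; apply/cochainsP => s sg.
rewrite !coboundaryE linear_sum scaler_sumr (reindex_inj (@perm_inj _ sg^-1%g)) /=.
apply: eq_bigr => i _; set j := (sg^-1%g i).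
have sgj : sg j = i by rewrite permKV.
have [t tE] := perm_lift_factor sg j.
have sdE : odel (operm s sg) j = operm (odel s i) t.
  apply: oface_inj => l; rewrite tnth_odel !tnth_operm tnth_odel.
  by rewrite -{1}tE lift_perm_lift sgj.
have pr : val (oset (operm (odel s i) t)) \proper val (oset (operm s sg)).
  by rewrite -sdE odel_proper.
rewrite (res_eq f _ pr sdE) fP [in LHS]linearZ [in RHS]linearZ /=.
rewrite (res_cast _ (oset_perm s sg) (odel_proper s i)) !scalerA.
congr (_ *: _); rewrite -[_ ^+ j]signr_odd -[_ ^+ i]signr_odd -!signr_addb.
(* The parity of [sg] is the sum of those of i, j and [t], so (-1)^j sgn(t) = sgn(sg) (-1)^i. *)
by congr (_ ^+ nat_of_bool _); rewrite -[in RHS]tE odd_lift_perm sgj;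
  case: (odd j); case: (odd i); case: (odd_perm t).
Qed.

End Complex.

Lemma dim_limg_inj (K : fieldType) (aT rT : vectType K) (f : 'Hom(aT, rT))
    (U : {vspace aT}) : lker f == 0%VS -> \dim (f @: U) = \dim U.
Proof. by move=> /eqP kf; apply: limg_dim_eq; rewrite kf capv0. Qed.

(** * Relations between the dimensions of cochains, cocycles, coboundaries and cohomology *)

Section HDim.
Variables (X : scomplex) (K : fieldType) (F : sheaf K X).

Lemma coboundaries_cocycles n : (coboundaries F n <= cocycles F n)%VS.
Proof.
case: n => [|n] /=; first exact: sub0v.
rewrite subv_cap coboundary_cochains; apply/subvP=> _ /memv_imgP[f _ ->].
by rewrite memv_ker coboundary_coboundary.
Qed.

Lemma dim_cocycles n :
  (\dim (cocycles F n) + \dim (coboundaries F n.+1) = \dim (cochains F n))%N.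
Proof. exact: limg_ker_dim. Qed.

(** The quotient is taken by the preimage of B^n under the inclusion [f] of Z^n. As [f] is injective
    and its image Z^n contains B^n, this preimage has the dimension of B^n. *)
Lemma hdim_cocycles (n : nat) :
  (hdim F n + \dim (coboundaries F n) = \dim (cocycles F n))%N.
Proof.
rewrite /hdim /cohomology dim_vquot; set f := linfun _.
have fE (x : subvs_of (cocycles F n)) : f x = vsval x by rewrite lfunE.
have kf : lker f == 0%VS.
  by apply/lker0P=> x y; rewrite !fE => /val_inj.
have imf : limg f = cocycles F n.
  apply/eqP; rewrite eqEsubv; apply/andP; split; apply/subvP=> v.
    by case/memv_imgP=> x _ ->; rewrite fE subvsP.
  by move=> vZ; rewrite -(vsprojK vZ) -fE memv_img ?memvf.
have <- : \dim (f @^-1: coboundaries F n) = \dim (coboundaries F n).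
  rewrite -[in RHS](@lpreimK _ _ _ f (coboundaries F n)) ?imf ?coboundaries_cocycles //.
  by rewrite (dim_limg_inj _ kf).
rewrite subnK; last by rewrite dimvS ?subvf.
by rewrite -[in RHS]imf (dim_limg_inj _ kf).
Qed.

End HDim.

(** * Pulling back cochains *)

(** This is what makes the image of an ordered face an ordered face. Both coverings and translations
    by group elements satisfy it, so one pullback construction serves for both. *)
Definition face_inj (Y X : scomplex) (u : smorph Y X) :=
  forall y : {set Y}, y \in faces Y -> {in y &, injective u}.

Section OrientedImage.
Variables (Y X : scomplex) (u : smorph Y X) (u_inj : face_inj u).

Fact oimg_subproof k (s : oface Y k) :
  uniq (map_tuple u (val s)) && ([set v in map_tuple u (val s)] \in faces X).
Proof.
have /andP[us sF] := valP s; apply/andP; split.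
  rewrite map_inj_in_uniq // => v w vs ws; apply: (u_inj sF); by rewrite inE.
suff -> : [set v in map_tuple u (val s)] = u @: [set v in val s] by apply: smap_face.
apply/setP=> v; rewrite inE; apply/mapP/imsetP => -[w ws ->].
  by exists w; rewrite ?inE.
by rewrite inE in ws; exists w.
Qed.

Definition oimg k (s : oface Y k) : oface X k := Sub (map_tuple u (val s)) (oimg_subproof s).

Lemma tnth_oimg k (s : oface Y k) i : tnth (val (oimg s)) i = u (tnth (val s) i).
Proof. by rewrite /= tnth_map. Qed.

Lemma oimg_perm k (s : oface Y k) sg : oimg (operm s sg) = operm (oimg s) sg.
Proof. by apply: oface_inj => i; rewrite tnth_oimg !tnth_operm tnth_oimg. Qed.

Lemma oimg_del k (s : oface Y k.+1) i : oimg (odel s i) = odel (oimg s) i.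
Proof. by apply: oface_inj => j; rewrite tnth_oimg !tnth_odel tnth_oimg. Qed.

Lemma oset_oimg k (s : oface Y k) : u @: val (oset s) = val (oset (oimg s)).
Proof.
apply/setP=> v; rewrite !inE; apply/imsetP/mapP => -[w ws ->].
  by rewrite inE in ws; exists w.
by exists w; rewrite ?inE.
Qed.

End OrientedImage.

(* [G] is identified with the pullback of [F] along [u].  Indexing the stalk
   maps by pairs [y], [x] with [u @: y = x] spares all transports between
   propositionally equal faces. *)
Record stalk_iso (K : fieldType) (Y X : scomplex) (u : smorph Y X)
    (F : sheaf K X) (G : sheaf K Y) := StalkIso {
  si : forall (y : nface Y) (x : nface X), u @: val y = val x -> 'Hom(F x, G y);
  sinv : forall (y : nface Y) (x : nface X), u @: val y = val x -> 'Hom(G y, F x);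
  siK : forall (y : nface Y) (x : nface X) (e : u @: val y = val x), cancel (si e) (sinv e);
  sinvK : forall (y : nface Y) (x : nface X) (e : u @: val y = val x), cancel (sinv e) (si e);
  si_res : forall (y y' : nface Y) (x x' : nface X)
      (e : u @: val y = val x) (e' : u @: val y' = val x')
      (yy' : val y \proper val y') (xx' : val x \proper val x') (a : F x),
    res G yy' (si e a) = si e' (res F xx' a)
}.

Section Pull.
Variables (K : fieldType) (Y X : scomplex) (u : smorph Y X) (u_inj : face_inj u).
Variables (F : sheaf K X) (G : sheaf K Y) (phi : stalk_iso u F G).

Lemma si_cast (y y' : nface Y) (x x' : nface X) (ey : y = y') (ex : x = x')
    (e : u @: val y = val x) (e' : u @: val y' = val x') (a : F x) :
  si phi e' (stalk_cast ex a) = stalk_cast ey (si phi e a).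
Proof. by case: y' / ey e'; case: x' / ex => e'; rewrite (eq_irrelevance e e'). Qed.

Lemma sinv_cast (y y' : nface Y) (x x' : nface X) (ey : y = y') (ex : x = x')
    (e : u @: val y = val x) (e' : u @: val y' = val x') (a : G y) :
  sinv phi e' (stalk_cast ey a) = stalk_cast ex (sinv phi e a).
Proof. by case: y' / ey e'; case: x' / ex => e'; rewrite (eq_irrelevance e e'). Qed.

Definition pull_fun k (f : ofam F k) : ofam G k :=
  [ffun s => si phi (oset_oimg u_inj s) (f (oimg u_inj s))].

Fact pull_is_linear k : linear (@pull_fun k).
Proof.
by move=> a f g; apply/ffunP=> s; rewrite famDE famZE !ffunE linearP.
Qed.

HB.instance Definition _ k :=
  GRing.isLinear.Build K (ofam F k) (ofam G k) _ (@pull_fun k) (@pull_is_linear k).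

Definition pull k : 'Hom(ofam F k, ofam G k) := linfun (@pull_fun k).

Lemma oimg_oset k (s : oface Y k) x : oimg u_inj s = x -> u @: val (oset s) = val (oset x).
Proof. by move=> <-; apply: oset_oimg. Qed.

(** Leaving the image face as a variable [x] lets [f] be evaluated on any form of it, such as a
    permuted or deleted face. *)
Lemma pullE k (f : ofam F k) s x (e : oimg u_inj s = x) :
  pull k f s = si phi (oimg_oset e) (f x).
Proof.
rewrite lfunE /= ffunE; case: x / e.
by rewrite (eq_irrelevance (oset_oimg u_inj s) (oimg_oset erefl)).
Qed.

Lemma pull_cochains k : (pull k @: cochains F k <= cochains G k)%VS.
Proof.
apply/subvP=> _ /memv_imgP[f /cochainsP fP ->]; apply/cochainsP => s sg.
rewrite (pullE _ (oimg_perm u_inj s sg)) (pullE _ (erefl (oimg u_inj s))) fP.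
by rewrite linearZ /= (si_cast (oset_perm s sg) _ (oimg_oset erefl)).
Qed.

Lemma pull_coboundary k f : pull k.+1 (coboundary F k f) = coboundary G k (pull k f).
Proof.
apply/ffunP=> s; rewrite (pullE _ (erefl (oimg u_inj s))) !coboundaryE linear_sum.
apply: eq_bigr => i _; rewrite linearZ /=; congr (_ *: _).
rewrite (pullE _ (oimg_del u_inj s i)).
by rewrite (si_res phi _ (oimg_oset erefl) _ (odel_proper (oimg u_inj s) i)).
Qed.

Lemma pull_inj k : (forall x : oface X k, exists s, oimg u_inj s = x) ->
  lker (pull k) == 0%VS.
Proof.
move=> surj; apply/lker0P=> f g fg; apply/ffunP=> x; have [s e] := surj x.
have := congr1 (fun h : ofam G k => h s) fg; rewrite !(pullE _ e).
by move=> /(can_inj (siK phi _)).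
Qed.

End Pull.

(** * Galois coverings *)

Lemma fam_sumE (K : fieldType) (I : finType) (T : I -> vectType K)
    (J : finType) (f : J -> fam T) i : (\sum_j f j) i = \sum_j f j i.
Proof.
by apply: (big_morph (fun g : fam T => g i)) => [g h|]; rewrite ?famDE ?fam0E.
Qed.

(** If v and w in one face had the same image, the faces {v} and {v, w} in the star of v would have
    the same image as well. *)
Lemma covering_face_inj (Y X : scomplex) (u : smorph Y X) : covering u -> face_inj u.
Proof.
move=> cov y yF v w vy wy uvw; have [inj_v _] := cov.2 v.
have vwF : [set v; w] \in faces Y.
  by apply: faceS yF _; apply/subsetP=> z /set2P[] ->.
have : [set v; w] = [set v].
  apply: inj_v; rewrite ?inE ?face1 ?vwF ?eqxx //.
  by rewrite imsetU1 !imset_set1 uvw setUid.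
by move=> /setP/(_ w); rewrite !inE eqxx orbT => /esym/eqP.
Qed.

(** Lift the first vertex to [y0], use the bijection of stars to lift the whole face to some [a],
    and pick in [a] a preimage of each vertex in order. *)
Lemma covering_oimg_surj (Y X : scomplex) (u : smorph Y X) (u_inj : face_inj u) k :
  covering u -> forall x : oface X k, exists s, oimg u_inj s = x.
Proof.
move=> cov x; have [y0 y0E] := cov.1 (tnth (val x) ord0).
have /andP[ux xF] := valP x; have [_ starE] := cov.2 y0.
have : [set v in val x] \in star (u y0) by rewrite inE xF inE y0E mem_tnth.
rewrite -starE => /imsetP[a]; rewrite inE => /andP[aF _] xE.
have lift_vertex i : exists v, (v \in a) && (u v == tnth (val x) i).
  have : tnth (val x) i \in u @: a by rewrite -xE inE mem_tnth.
  by case/imsetP=> v va ->; exists v; rewrite va eqxx.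
pose v i := xchoose (lift_vertex i).
have va i : v i \in a by have /andP[] := xchooseP (lift_vertex i).
have uv i : u (v i) = tnth (val x) i by have /andP[_ /eqP] := xchooseP (lift_vertex i).
pose t := [tuple v i | i < k.+1].
have tP : uniq t && ([set z in t] \in faces Y).
  apply/andP; split.
    rewrite map_inj_uniq ?enum_uniq // => i j vij.
    by apply: (tuple_uniqP _ ux); rewrite -!uv vij.
  apply: faceS aF _; apply/subsetP=> w; rewrite inE => /tnthP[i ->].
  by rewrite tnth_mktuple.
by exists (Sub t tP : oface Y k); apply: oface_inj => i; rewrite tnth_oimg /= tnth_mktuple.
Qed.

(** * A single Galois covering, later with cyclic group of order p *)

Section GaloisStep.
Variables (K : fieldType) (Y X : scomplex) (w : smorph Y X) (w_inj : face_inj w).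
Hypothesis cov_w : covering w.
Variables (F : sheaf K X) (G : sheaf K Y) (phi : stalk_iso w F G).
Variables (gT : finGroupType) (to : {action gT &-> Y}).
Hypothesis to_face : forall (g : gT) (y : {set Y}),
  y \in faces Y -> [set to v g | v in y] \in faces Y.
Hypothesis to_fibre : forall (g : gT) (v : Y), w (to v g) = w v.
Hypothesis to_trans : forall x : {set X}, x \in faces X -> x != set0 ->
  forall y y' : {set Y}, y \in faces Y -> y' \in faces Y ->
    w @: y = x -> w @: y' = x -> exists! g : gT, [set to v g | v in y] = y'.

Definition act_smorph g : smorph Y Y := @SMorph Y Y (fun v => to v g) (to_face g).

Lemma act_face_inj g : face_inj (act_smorph g).
Proof. by move=> y _ v v' _ _; apply: act_inj. Qed.

Arguments act_face_inj : clear implicits.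

Definition oact k g (s : oface Y k) : oface Y k := oimg (act_face_inj g) s.

Lemma oimg_oact k g (s : oface Y k) : oimg w_inj (oact g s) = oimg w_inj s.
Proof. by apply: oface_inj => i; rewrite !tnth_oimg /= to_fibre. Qed.

Lemma oactM k g h (s : oface Y k) : oact (g * h)%g s = oact h (oact g s).
Proof. by apply: oface_inj => i; rewrite !tnth_oimg /= actM. Qed.

Lemma oact1 k (s : oface Y k) : oact 1%g s = s.
Proof. by apply: oface_inj => i; rewrite !tnth_oimg /= act1. Qed.

(** The group element matching the underlying sets also matches the orderings, because [w] is
    injective on the face of [s']. *)
Lemma oact_trans k (s s' : oface Y k) :
  oimg w_inj s = oimg w_inj s' -> exists g, oact g s = s'.
Proof.
move=> ss'; have /andP[sF s0] := oset_subproof s.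
have /andP[s'F _] := oset_subproof s'.
have /andP[xF x0] := oset_subproof (oimg w_inj s).
have [g [gE _]] := to_trans xF x0 sF s'F (oset_oimg _ s)
  (etrans (oset_oimg w_inj s') (congr1 (fun t => val (oset t)) (esym ss'))).
exists g; apply: oface_inj => i; apply: (w_inj s'F).
- by rewrite -gE tnth_oimg; apply: imset_f; rewrite inE mem_tnth.
- by rewrite inE mem_tnth.
- by rewrite -!(tnth_oimg w_inj) oimg_oact ss'.
Qed.

Lemma act_img g (y x : nface Y) : act_smorph g @: val y = val x ->
  w @: val x = val (nimg w y).
Proof.
move=> <-; rewrite -imset_comp /=; apply: eq_imset => v /=; exact: to_fibre.
Qed.

Lemma sinv_res (y y' : nface Y) (x x' : nface X) (e : w @: val y = val x)
    (e' : w @: val y' = val x') (yy' : val y \proper val y') (xx' : val x \proper val x')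
    (a : G y) :
  res F xx' (sinv phi e a) = sinv phi e' (res G yy' a).
Proof. by apply: (can_inj (siK phi e')); rewrite sinvK -(si_res phi e e' yy') sinvK. Qed.

Fact imset_nimg (y : nface Y) : w @: val y = val (nimg w y). Proof. by []. Qed.

(** Faces in one orbit have the same image under [w], so both stalks are identified with one stalk
    of [F]. *)
Definition act_si g (y x : nface Y) (e : act_smorph g @: val y = val x) : 'Hom(G x, G y) :=
  (si phi (imset_nimg y) \o sinv phi (act_img e))%VF.
Definition act_sinv g (y x : nface Y) (e : act_smorph g @: val y = val x) : 'Hom(G y, G x) :=
  (si phi (act_img e) \o sinv phi (imset_nimg y))%VF.

Fact act_siK g (y x : nface Y) (e : act_smorph g @: val y = val x) :
  cancel (act_si e) (act_sinv e).
Proof. by move=> a; rewrite !comp_lfunE siK sinvK. Qed.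

Fact act_sinvK g (y x : nface Y) (e : act_smorph g @: val y = val x) :
  cancel (act_sinv e) (act_si e).
Proof. by move=> a; rewrite !comp_lfunE siK sinvK. Qed.

Fact act_si_res g (y y' x x' : nface Y)
    (e : act_smorph g @: val y = val x) (e' : act_smorph g @: val y' = val x')
    (yy' : val y \proper val y') (xx' : val x \proper val x') a :
  res G yy' (act_si e a) = act_si e' (res G xx' a).
Proof.
rewrite !comp_lfunE /= (si_res phi _ (imset_nimg y') _ (nimg_proper cov_w yy')).
by rewrite (sinv_res _ (act_img e') xx').
Qed.

Definition act_iso g : stalk_iso (act_smorph g) G G :=
  StalkIso (@act_siK g) (@act_sinvK g) (@act_si_res g).

(** For a generator [g] this is the operator to which the dimension bounds are applied. *)
Definition translate k g : 'End(ofam G k) := pull (act_face_inj g) (act_iso g) k.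

(** Reading values in the stalk of [F] below makes values of [f] on different faces of one orbit
    comparable. *)
Definition coord k (f : ofam G k) s x (e : oimg w_inj s = x) : F (oset x) :=
  sinv phi (oimg_oset e) (f s).

Lemma coord_inj k (f f' : ofam G k) :
  (forall s, coord f (erefl (oimg w_inj s)) = coord f' (erefl (oimg w_inj s))) -> f = f'.
Proof.
by move=> ff'; apply/ffunP=> s;
  apply: (can_inj (sinvK phi (oimg_oset (erefl (oimg w_inj s)))));
  apply: ff'.
Qed.

Lemma coord_irrelevant k (f : ofam G k) s s' x (e : oimg w_inj s = x) (e' : oimg w_inj s' = x) :
  s = s' -> coord f e = coord f e'.
Proof. by move=> ss'; case: s' / ss' e' => e'; rewrite (eq_irrelevance e e'). Qed.

Lemma coord_pull k (h : ofam F k) s x (e : oimg w_inj s = x) :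
  coord (pull w_inj phi k h) e = h x.
Proof. by rewrite /coord (pullE _ _ e) siK. Qed.

Lemma si_sinv_irrelevant (y y' : nface Y) (z z' : nface X)
    (e1 : w @: val y = val z) (e2 : w @: val y' = val z)
    (e1' : w @: val y = val z') (e2' : w @: val y' = val z') (a : G y') :
  si phi e1 (sinv phi e2 a) = si phi e1' (sinv phi e2' a).
Proof.
have zz' : z = z' by apply: val_inj; rewrite /= -e1.
case: z' / zz' e1' e2' => e1' e2'.
by rewrite (eq_irrelevance e1 e1') (eq_irrelevance e2 e2').
Qed.

Lemma coord_translate k g (f : ofam G k) s x (e : oimg w_inj s = x)
    (e' : oimg w_inj (oact g s) = x) :
  coord (translate k g f) e = coord f e'.
Proof.
rewrite /coord /translate (pullE _ _ (erefl (oact g s))) comp_lfunE.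
by rewrite (si_sinv_irrelevant _ _ (oimg_oset e) (oimg_oset e')) siK.
Qed.

Lemma coord_iter_translate k g (f : ofam G k) i s x (e : oimg w_inj s = x)
    (e' : oimg w_inj (oact (g ^+ i)%g s) = x) :
  coord (iter i (translate k g) f) e = coord f e'.
Proof.
elim: i s e e' => [|i IHi] s e e'; first by apply: coord_irrelevant; rewrite expg0 oact1.
have e1 : oimg w_inj (oact g s) = x by rewrite oimg_oact.
have e2 : oimg w_inj (oact (g ^+ i)%g (oact g s)) = x by rewrite !oimg_oact.
rewrite iterS (coord_translate _ _ e1) (IHi _ e1 e2).
by apply: coord_irrelevant; rewrite -oactM -expgS.
Qed.

Variables (p : nat) (g : gT).
Hypotheses (genG : [set: gT] = <[g]>%g) (cardG : #[g]%g = p).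

Lemma iter_translate_period k (f : ofam G k) : iter p (translate k g) f = f.
Proof.
apply: coord_inj => s.
have e : oimg w_inj (oact (g ^+ p)%g s) = oimg w_inj s by rewrite oimg_oact.
rewrite (coord_iter_translate _ _ e); apply: coord_irrelevant.
by rewrite -cardG expg_order oact1.
Qed.

(** A cochain fixed by the generator is fixed by all its powers, so by transitivity its coordinates
    are constant on fibres. Reading them at a chosen lift of each face defines the cochain [h]
    below. *)
Lemma translate_fixed k (f : ofam G k) : f \in cochains G k ->
  translate k g f = f -> f \in (pull w_inj phi k @: cochains F k)%VS.
Proof.
move=> /cochainsP fP gf; have gif i : iter i (translate k g) f = f.
  by elim: i => //= i ->.
have coordE s s' x (e : oimg w_inj s = x) (e' : oimg w_inj s' = x) : coord f e = coord f e'.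
  have [h hE] := oact_trans (etrans e (esym e')).
  have /cycleP[i hgi] : h \in <[g]>%g by rewrite -genG inE.
  have e1 : oimg w_inj (oact (g ^+ i)%g s) = x by rewrite oimg_oact.
  rewrite -{1}(gif i) (coord_iter_translate _ e e1); apply: coord_irrelevant.
  by rewrite -hgi.
pose surj := covering_oimg_surj w_inj cov_w.
have lift_ex x : exists s : oface Y k, oimg w_inj s == x.
  by have [s /eqP] := surj k x; exists s.
have liftP x := eqP (xchooseP (lift_ex x)).
pose h : ofam F k := [ffun x => coord f (liftP x)].
have hE s x (e : oimg w_inj s = x) : coord f e = h x by rewrite ffunE; apply: coordE.
apply/memv_imgP; exists h.
  apply/cochainsP=> x sg.
  have e : oimg w_inj (operm (xchoose (lift_ex x)) sg) = operm x sg.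
    by rewrite oimg_perm liftP.
  rewrite -(hE _ _ e) -(hE _ _ (liftP x)) /coord fP linearZ /=.
  by rewrite (sinv_cast _ _ (oset_perm x sg) (oimg_oset (liftP x))).
by apply: coord_inj => s; rewrite coord_pull hE.
Qed.

(* Cutting [pull h] down to one face in each orbit inverts the norm. *)
Lemma pull_norm k (h : ofam F k) : h \in cochains F k ->
  exists2 f, f \in cochains G k &
    pull w_inj phi k h = \sum_(i < p) iter i (translate k g) f.
Proof.
move=> hC; have : pull w_inj phi k h \in cochains G k.
  by apply: (subvP (pull_cochains w_inj phi k)); apply: memv_img.
set ph := pull _ _ _ h => /cochainsP phP.
(* [L] picks one face over each face below; the default [set0] is not taken at images of faces.
   Since [R] looks only at the unordered face, cutting down by it keeps the family alternating. *)
pose L (x : {set X}) := odflt set0 [pick y in faces Y | w @: y == x].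
pose R (y : nface Y) := val y == L (w @: val y).
pose f : ofam G k := [ffun s => if R (oset s) then ph s else 0].
exists f.
  apply/cochainsP=> s sg; rewrite !ffunE.
  have -> : R (oset (operm s sg)) = R (oset s) by rewrite -oset_perm.
  by case: ifP => _; rewrite ?phP // linear0 scaler0.
apply: coord_inj => s; set x := oimg w_inj s.
rewrite coord_pull /coord fam_sumE linear_sum /=.
have e i : oimg w_inj (oact (g ^+ i)%g s) = x by rewrite oimg_oact.
transitivity (\sum_(i < p) coord f (e i)); last first.
  by apply: eq_bigr => i _; rewrite -(coord_iter_translate _ (erefl x)).
have /andP[sF s0] := oset_subproof s.
have /andP[xF x0] := oset_subproof x.
have wsx : w @: [set v in val s] = [set v in val x] by apply: oset_oimg.
have [LF wL] : L [set v in val x] \in faces Y /\ w @: L [set v in val x] = [set v in val x].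
  rewrite /L; case: pickP => [y /andP[yF /eqP]|/(_ [set v in val s])] //.
  by rewrite wsx sF eqxx.
have fE i : coord f (e i) =
    if [set to v (g ^+ i)%g | v in [set v in val s]] == L [set v in val x] then h x else 0.
  rewrite /coord ffunE /R.
  have -> : val (oset (oact (g ^+ i)%g s)) = [set to v (g ^+ i)%g | v in [set v in val s]].
    exact/esym/(oset_oimg (act_face_inj (g ^+ i)%g) s).
  have -> : w @: [set to v (g ^+ i)%g | v in [set v in val s]] = [set v in val x].
    by rewrite -wsx -imset_comp; apply: eq_imset => v /=; apply: to_fibre.
  by case: ifP => _; rewrite ?linear0 // -/(coord ph (e i)) coord_pull.
(* By simple transitivity exactly one power of [g] with exponent below p moves the face to the
   chosen one, so a single term of the norm survives. *)
have [g0 [g0E g0U]] := to_trans xF x0 sF LF wsx wL.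
have /cyclePmin[i ip g0i] : g0 \in <[g]>%g by rewrite -genG inE.
rewrite cardG in ip; rewrite (bigD1 (Ordinal ip)) //= big1 => [|j ji].
  by rewrite addr0 fE /= -g0i g0E eqxx.
rewrite fE; case: eqP => // /g0U; rewrite g0i => /eqP.
rewrite eq_expg_mod_order cardG !modn_small // => /eqP ij.
by case/eqP: ji; apply: val_inj.
Qed.

Hypotheses (p_prime : prime p) (charK : p \in [pchar K]).

Lemma translate_cochains k : (translate k g @: cochains G k <= cochains G k)%VS.
Proof. exact: pull_cochains. Qed.

Lemma translate_coboundary k f :
  translate k.+1 g (coboundary G k f) = coboundary G k (translate k g f).
Proof. exact: pull_coboundary. Qed.

(** The injective image of the cochains below contains all fixed cochains, which bounds the left
    side above, and consists of norms, which bounds it below. *)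
Lemma galois_dim_cochains k : \dim (cochains G k) = (p * \dim (cochains F k))%N.
Proof.
rewrite -(dim_limg_inj (cochains F k) (pull_inj phi (covering_oimg_surj w_inj cov_w (k := k)))).
apply/eqP; rewrite eqn_leq; apply/andP; split.
  apply: (cyclic_dim_le p_prime charK (translate_cochains k)).
    by move=> f _; apply: iter_translate_period.
  by move=> f; apply: translate_fixed.
apply: (cyclic_dim_ge p_prime charK (translate_cochains k)).
  by move=> f _; apply: iter_translate_period.
by move=> _ /memv_imgP[h /pull_norm hC ->].
Qed.

(** Only the norm argument carries over: if the pullback of h is the norm of f, the pullback of dh
    is the norm of df. A fixed coboundary need not come from a coboundary below. *)
Lemma galois_dim_coboundaries k :
  (p * \dim (coboundaries F k) <= \dim (coboundaries G k))%N.
Proof.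
case: k => [|k]; first by rewrite /= dimv0 muln0.
rewrite -(dim_limg_inj _ (pull_inj phi (covering_oimg_surj w_inj cov_w (k := k.+1)))).
apply: (cyclic_dim_ge p_prime charK (s := translate k.+1 g)) => /=.
- apply/subvP=> _ /memv_imgP[_ /memv_imgP[f fC ->] ->].
  rewrite translate_coboundary memv_img // (subvP (translate_cochains k)) //.
  exact: memv_img.
- by move=> f _; apply: iter_translate_period.
move=> _ /memv_imgP[_ /memv_imgP[h hC ->] ->].
have [f fC fE] := pull_norm hC; exists (coboundary G k f); first exact: memv_img.
rewrite pull_coboundary fE linear_sum; apply: eq_bigr => i _.
by elim: (nat_of_ord i) => //= j IHj; rewrite -translate_coboundary IHj.
Qed.

End GaloisStep.

(** * Towers *)

Lemma covering_id (X : scomplex) (u : smorph X X) : u =1 id -> covering u.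
Proof.
move=> u1; have uE (a : {set X}) : u @: a = a by rewrite (eq_imset _ u1) imset_id.
split=> [x|y]; first by exists x.
split=> [a b _ _|]; first by rewrite !uE.
by rewrite (eq_imset _ uE) imset_id u1.
Qed.

Lemma covering_comp (Y Z X : scomplex) (v : smorph Z X) (w : smorph Y Z)
    (u : smorph Y X) : covering v -> covering w -> u =1 v \o w -> covering u.
Proof.
move=> cv cw uvw; have uE (a : {set Y}) : u @: a = v @: (w @: a).
  by rewrite (eq_imset _ uvw) imset_comp.
split=> [x|y].
  by have [z <-] := cv.1 x; have [y <-] := cw.1 z; exists y; rewrite uvw.
have [w_inj wE] := cw.2 y; have [v_inj vE] := cv.2 (w y).
split=> [a b ay by_|].
  by rewrite !uE => /v_inj ab; apply: w_inj => //; apply: ab; rewrite -wE imset_f.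
by rewrite (eq_imset _ uE) (imset_comp (fun b : {set Z} => v @: b)) wE vE uvw.
Qed.

(** * Identifications of pulled back sheaves *)

Section PullbackIso.
Variables (K : fieldType) (Y X : scomplex) (u : smorph Y X) (cov_u : covering u).
Variable F : sheaf K X.

Fact nimg_eq (y : nface Y) (x : nface X) : u @: val y = val x -> nimg u y = x.
Proof. by move=> e; apply: val_inj. Qed.

Definition pullback_si (y : nface Y) (x : nface X) (e : u @: val y = val x) :
    'Hom(F x, pullback cov_u F y) :=
  ecast z ('Hom(F x, F z)) (esym (nimg_eq e)) \1%VF.
Definition pullback_sinv (y : nface Y) (x : nface X) (e : u @: val y = val x) :
    'Hom(pullback cov_u F y, F x) :=
  ecast z ('Hom(F (nimg u y), F z)) (nimg_eq e) \1%VF.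

Fact pullback_siK (y : nface Y) (x : nface X) (e : u @: val y = val x) :
  cancel (pullback_si e) (pullback_sinv e).
Proof.
rewrite /pullback_si /pullback_sinv; move: (nimg_eq e) => {}e; case: x / e => a /=.
by rewrite !id_lfunE.
Qed.

Fact pullback_sinvK (y : nface Y) (x : nface X) (e : u @: val y = val x) :
  cancel (pullback_sinv e) (pullback_si e).
Proof.
rewrite /pullback_si /pullback_sinv; move: (nimg_eq e) => {}e; case: x / e => a /=.
by rewrite !id_lfunE.
Qed.

Fact pullback_si_res (y y' : nface Y) (x x' : nface X)
    (e : u @: val y = val x) (e' : u @: val y' = val x')
    (yy' : val y \proper val y') (xx' : val x \proper val x') a :
  res (pullback cov_u F) yy' (pullback_si e a) = pullback_si e' (res F xx' a).
Proof.
rewrite /pullback_si; move: (nimg_eq e) (nimg_eq e') xx' a => {}e {}e'.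
case: x / e; case: x' / e' => xx' a /=; rewrite !id_lfunE.
by rewrite (res_irrelevant F xx' (nimg_proper cov_u yy')).
Qed.

Definition pullback_iso : stalk_iso u F (pullback cov_u F) :=
  StalkIso pullback_siK pullback_sinvK pullback_si_res.

End PullbackIso.

Section CompIso.
Variables (K : fieldType) (Y Z X : scomplex).
Variables (v : smorph Z X) (w : smorph Y Z) (u : smorph Y X).
Hypotheses (cov_v : covering v) (uvw : u =1 v \o w).
Variables (F : sheaf K X) (G : sheaf K Y) (phi : stalk_iso u F G).

Fact comp_img (y : nface Y) (z : nface Z) :
  w @: val y = val z -> u @: val y = val (nimg v z).
Proof. by move=> e; rewrite (eq_imset _ uvw) imset_comp e. Qed.

(* The pullback of [F] along [v] has stalk [F (v z)] at [z], so the stalk maps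
   of [phi] serve unchanged. *)
Definition factor_iso : stalk_iso w (pullback cov_v F) G :=
  @StalkIso K Y Z w (pullback cov_v F) G
    (fun y z e => si phi (comp_img e)) (fun y z e => sinv phi (comp_img e))
    (fun y z e => siK phi (comp_img e)) (fun y z e => sinvK phi (comp_img e))
    (fun y y' z z' e e' yy' zz' a =>
       si_res phi (comp_img e) (comp_img e') yy' (nimg_proper cov_v zz') a).

End CompIso.

Section Monotone.
Variables (K : fieldType) (Y X : scomplex) (u : smorph Y X) (cov_u : covering u).
Variables (F : sheaf K X) (G : sheaf K Y) (phi : stalk_iso u F G).

Let u_inj : face_inj u := covering_face_inj cov_u.

(** Pulling back is injective because every face lifts. For a tower of length 0 this is applied to
    an identification and to its inverse, giving equality. *)
Lemma covering_dim_cochains k : (\dim (cochains F k) <= \dim (cochains G k))%N.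
Proof.
rewrite -(dim_limg_inj _ (pull_inj phi (covering_oimg_surj u_inj cov_u (k := k)))).
exact/dimvS/pull_cochains.
Qed.

Lemma covering_dim_coboundaries k :
  (\dim (coboundaries F k) <= \dim (coboundaries G k))%N.
Proof.
case: k => [|k]; first by rewrite /= dimv0.
rewrite -(dim_limg_inj _ (pull_inj phi (covering_oimg_surj u_inj cov_u (k := k.+1)))).
apply/dimvS/subvP=> _ /memv_imgP[_ /memv_imgP[f fC ->] ->].
rewrite pull_coboundary memv_img //.
by apply: (subvP (pull_cochains u_inj phi k)); apply: memv_img.
Qed.

End Monotone.

Section IdIso.
Variables (K : fieldType) (X : scomplex) (u : smorph X X) (u1 : u =1 id).
Variables (F G : sheaf K X) (phi : stalk_iso u F G).

Fact id_img (y x : nface X) : u @: val y = val x -> u @: val x = val y.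
Proof. by rewrite !(eq_imset _ u1) !imset_id => ->. Qed.

Definition id_iso_inv : stalk_iso u G F :=
  @StalkIso K X X u G F
    (fun y x e => sinv phi (id_img e)) (fun y x e => si phi (id_img e))
    (fun y x e => sinvK phi (id_img e)) (fun y x e => siK phi (id_img e))
    (fun y y' x x' e e' yy' xx' a => sinv_res phi (id_img e) (id_img e') xx' yy' a).

End IdIso.

(** Quantifying over every [G] identified with the pullback lets the induction pass through the
    intermediate complex [Z]: [F] is first pulled back to [Z], and [factor_iso] identifies [G] with
    the pullback of that sheaf. *)
Lemma cyclic_tower_dims (p : nat) (p_prime : prime p) (K : fieldType)
    (charK : p \in [pchar K]) (X : scomplex) (F : sheaf K X) (r : nat)
    (Y : scomplex) (u : smorph Y X) :
  cyclic_tower p r u ->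
  covering u /\ forall (G : sheaf K Y), stalk_iso u F G -> forall k,
    \dim (cochains G k) = (p ^ r * \dim (cochains F k))%N /\
    (p ^ r * \dim (coboundaries F k) <= \dim (coboundaries G k))%N.
Proof.
elim=> {r Y u} [u u1|r Z Y v w u _ [cov_v IHv] [gT [cycG cardG [cov_w galG]]] uvw].
  have cov_u := covering_id u1; split=> // G phi k; rewrite !mul1n; split.
    apply/eqP; rewrite eqn_leq (covering_dim_cochains cov_u phi).
    by rewrite (covering_dim_cochains cov_u (id_iso_inv u1 phi)).
  exact: covering_dim_coboundaries phi k.
have cov_u := covering_comp cov_v cov_w uvw; split=> // G phi k.
have [cH bH] := IHv _ (pullback_iso cov_v F) k.
have [to [to_face to_fibre to_trans]] := galG.
have /cyclicP[g genG] := cycG.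
have og : #[g]%g = p by rewrite orderE -genG.
pose psi := factor_iso cov_v uvw phi.
have w_inj := covering_face_inj cov_w.
have cG := galois_dim_cochains w_inj cov_w psi
  to_face to_fibre to_trans genG og p_prime charK k.
have bG := galois_dim_coboundaries w_inj cov_w psi
  to_face to_fibre to_trans genG og p_prime charK k.
rewrite expnS cG cH mulnA; split=> //.
by apply: leq_trans bG; rewrite -mulnA leq_mul2l bH orbT.
Qed.

(** * The bounds on cohomology and on the rates *)

Theorem theorem10p3 (p : nat) (p_prime : prime p)
    (K : fieldType) (charK : p \in [pchar K])
    (X : scomplex) (d : nat) (dimX : sdim X = d%:Z)
    (k : nat) (k_le_d : (k <= d)%N)
    (F : sheaf K X)
    (hkm1 : hdim F (k%:Z - 1) = 0%N)
    (hk_gt : (hdim F (k%:Z + 1) < hdim F k%:Z)%N)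
    (r : nat) (Y : scomplex) (u : smorph Y X) (cov_u : covering u)
    (deg_u : has_degree u (p ^ r)) (tower_u : cyclic_tower p r u) :
  let rho : rat :=
    ((hdim F k%:Z)%:R - (hdim F (k%:Z + 1))%:R) / (\dim (cochains F k))%:R in
  let uF : sheaf K Y := pullback cov_u F in
  rho * (\dim (cochains uF k))%:R
      <= (hdim uF k%:Z)%:R - (hdim uF (k%:Z + 1))%:R
  /\ (rho * (\dim (cochains uF k))%:R <= (\dim (cocycles uF k))%:R
      /\ rho * (\dim (cochains uF k))%:R <= (hdim uF k%:Z)%:R
      /\ rho <= cocycle_code_rate uF k
      /\ rho <= cocycle_css_rate uF k).
Proof.
have kS : k%:Z + 1 = k.+1 by rewrite -PoszD addn1.
rewrite kS in hk_gt *; move=> rho uF.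
have [_ /(_ uF (pullback_iso cov_u F)) dims] := cyclic_tower_dims p_prime charK F tower_u.
have p_gt0 : (0 < p ^ r)%N by rewrite expn_gt0 prime_gt0.
have hE (W : scomplex) (H : sheaf K W) n :
    (hdim H n%:Z + \dim (coboundaries H n) + \dim (coboundaries H n.+1) =
     \dim (cochains H n))%N by rewrite hdim_cocycles dim_cocycles.
have hk1 := hdim_cocycles uF k.
have C_gt0 : (0 < \dim (cochains F k))%N by rewrite -hE; lia.
have [ck _] := dims k.
have CY_gt0 : (0 < \dim (cochains uF k))%N by rewrite ck muln_gt0 p_gt0.
(* This is p^r (h^k(X) - h^(k+1)(X)) <= h^k(Y) - h^(k+1)(Y), rearranged to avoid subtraction of
   naturals. *)
have main : (p ^ r * hdim F k%:Z + hdim uF k.+1%:Z <=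
             hdim uF k%:Z + p ^ r * hdim F k.+1%:Z)%N.
  have scale W (H : sheaf K W) n : (p ^ r * hdim H n%:Z + p ^ r * \dim (coboundaries H n)
      + p ^ r * \dim (coboundaries H n.+1) = p ^ r * \dim (cochains H n))%N.
    by rewrite -!mulnDr hE.
  have := (hE Y uF k, hE Y uF k.+1, scale X F k, scale X F k.+1).
  have := (dims k, dims k.+1, dims k.+2) => -[[[? _] [? _]] [_ ?]] [[[? ?] ?] ?].
  (* B^k enters with a negative sign and needs an upper bound. For k = 0 it vanishes; otherwise
     h^(k-1)(X) = 0 gives b^k(X) = c^(k-1)(X) - b^(k-1)(X), while b^k(Y) is at most c^(k-1)(Y) -
     b^(k-1)(Y). *)
  suff : (\dim (coboundaries uF k) <= p ^ r * \dim (coboundaries F k))%N by lia.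
  move: hkm1; case: (k) => [|j]; first by rewrite /= dimv0.
  have -> : j.+1%:Z - 1 = j by rewrite -addn1 PoszD addrK.
  move=> hj; have := scale X F j; rewrite hj muln0.
  by have := hE Y uF j; have [] := dims j; lia.
(* The dimension of C^k(Y) is p^r times the denominator of [rho], which cancels because it is
   positive. *)
have rhoE : rho * (\dim (cochains uF k))%:R =
    (p ^ r)%:R * ((hdim F k%:Z)%:R - (hdim F k.+1%:Z)%:R).
  by rewrite /rho ck natrM mulrCA [_ / _ * _]mulfVK // pnatr_eq0 -lt0n.
have i : rho * (\dim (cochains uF k))%:R <= (hdim uF k%:Z)%:R - (hdim uF k.+1%:Z)%:R.
  by rewrite rhoE mulrBr lerBlDr addrAC lerBrDr -!natrM -!natrD ler_nat.
have ii : rho * (\dim (cochains uF k))%:R <= (hdim uF k%:Z)%:R.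
  by apply: le_trans i _; rewrite lerBlDr lerDl ler0n.
have iii : rho * (\dim (cochains uF k))%:R <= (\dim (cocycles uF k))%:R.
  by apply: le_trans ii _; rewrite ler_nat -hk1 leq_addr.
by do !split=> //; rewrite /cocycle_code_rate /cocycle_css_rate ler_pdivlMr ?ltr0n.
Qed.
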